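(* Let $(\mathcal{P},\leqslant)$ be a finite poset with $n$ elements, let $e(\mathcal{P})$ be the number of its linear extensions, and let $a_1\geqslant a_2\geqslant\ldots$ and $c_1\geqslant c_2\geqslant\ldots$ be its antichain and chain Greene--Kleitman--Fomin parameters, respectively. Then $$\frac{n!}{\prod_i c_i!}\;\geqslant\; e(\mathcal{P})\;\geqslant\;\prod_i a_i!.$$
   Context: A linear extension of a finite poset $\mathcal{P}$ with $n$ elements is an order-preserving bijection $\mathcal{P}\to\{1,\ldots,n\}$ (i.e. a total order on $\mathcal{P}$ extending $\leqslant$); $e(\mathcal{P})$ denotes their number. The antichain Greene--Kleitman--Fomin parameters $a_1,a_2,\ldots$ are defined by requiring that, for each $k=1,2,\ldots$, $a_1+\ldots+a_k$ is the maximal number of elements of $\mathcal{P}$ that can be covered by (the union of) $k$ antichains. The chain Greene--Kleitman--Fomin parameters $c_1,c_2,\ldots$ are defined by requiring that, for each $k$, $c_1+\ldots+c_k$ is the maximal number of elements of $\mathcal{P}$ that can be covered by $k$ chains. (By the Greene--Kleitman--Fomin theorem both sequences are weakly decreasing and the partitions $n=a_1+a_2+\ldots$ and $n=c_1+c_2+\ldots$ are conjugate.) All but finitely many parameters are $0$, and $0!=1$. *)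

(* Defs.v *)
From mathcomp Require Import all_boot all_order all_algebra.

Set Implicit Arguments.
Unset Strict Implicit.
Unset Printing Implicit Defensive.

Import Order.TTheory GRing.Theory Num.Theory.

Section Posets.

Variables (disp : Order.disp_t) (T : finPOrderType disp).

Implicit Types (A : {set T}) (P : pred {set T}) (a : nat -> nat).

Definition is_chain A : bool := [forall x in A, forall y in A, (x >=< y)%O].

Definition is_antichain A : bool :=
  [forall x in A, forall y in A, (x != y) ==> (x >< y)%O].

(* The values are 0, ..., n - 1 rather than 1, ..., n. *)
Definition is_linear_extension (f : {ffun T -> 'I_#|T|}) : bool :=
  [&& injectiveb f, [forall i, exists x, f x == i]
    & [forall x, forall y, (x <= y)%O ==> (f x <= f y)]].

Definition num_linear_extensions : nat :=
  #|[set f : {ffun T -> 'I_#|T|} | is_linear_extension f]|.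

(* The k sets may overlap, coincide or be empty; the maximum is over a
   nonempty collection of families as soon as P set0 holds. *)
Definition max_cover P (k : nat) : nat :=
  \max_(F : {ffun 'I_k -> {set T}} | [forall i, P (F i)]) #|\bigcup_i F i|.

(* The parameters are a 1, a 2, ...; the value a 0 is irrelevant. *)
Definition gkf_parameters P a : Prop :=
  forall k, \sum_(1 <= i < k.+1) a i = max_cover P k.

Definition antichain_parameters a : Prop := gkf_parameters is_antichain a.

Definition chain_parameters a : Prop := gkf_parameters is_chain a.

Lemma is_chain0 : is_chain set0.
Proof. by apply/forall_inP=> x; rewrite inE. Qed.

Lemma is_antichain0 : is_antichain set0.
Proof. by apply/forall_inP=> x; rewrite inE. Qed.

Lemma is_chain1 x : is_chain [set x].
Proof.
apply/forall_inP=> y /set1P ->; apply/forall_inP=> z /set1P ->.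
exact: comparablexx.
Qed.

Lemma is_antichain1 x : is_antichain [set x].
Proof.
apply/forall_inP=> y /set1P ->; apply/forall_inP=> z /set1P ->.
by rewrite eqxx.
Qed.

Lemma max_cover0 P : max_cover P 0 = 0.
Proof.
apply/eqP; rewrite -leqn0; apply/bigmax_leqP=> F _.
by rewrite big_ord0 cards0.
Qed.

Lemma max_cover_le P k : max_cover P k <= #|T|.
Proof. by apply/bigmax_leqP=> F _; apply: max_card. Qed.

Lemma max_coverS P k : P set0 -> max_cover P k <= max_cover P k.+1.
Proof.
move=> P0; apply/bigmax_leqP=> F /forallP PF.
pose G : {ffun 'I_k.+1 -> {set T}} :=
  [ffun i => if unlift ord0 i is Some j then F j else set0].
apply: (@leq_trans #|\bigcup_i G i|).
  rewrite big_ord_recl ffunE unlift_none set0U.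
  by under [in leqRHS]eq_bigr do rewrite ffunE liftK.
apply: (leq_bigmax_cond (F := fun G : {ffun _ -> {set T}} => #|\bigcup_i G i|)).
by apply/forallP=> i; rewrite ffunE; case: unliftP.
Qed.

Lemma max_cover_full P k :
  P set0 -> (forall x, P [set x]) -> #|T| <= k -> max_cover P k = #|T|.
Proof.
move=> P0 P1 le_Tk; apply/eqP; rewrite eqn_leq max_cover_le /=.
elim: k le_Tk => [|k IHk]; first by rewrite leqn0 => /eqP ->.
rewrite leq_eqVlt => /predU1P [eqTk|/IHk le_k]; last first.
  exact: leq_trans le_k (max_coverS _ P0).
rewrite -eqTk -[leqLHS]cardsT.
pose G : {ffun 'I_#|T| -> {set T}} := [ffun i => [set enum_val i]].
have <- : \bigcup_i G i = [set: T].
  apply/setP=> x; rewrite inE; apply/bigcupP; exists (enum_rank x) => //.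
  by rewrite ffunE enum_rankK set11.
apply: (leq_bigmax_cond (F := fun G : {ffun _ -> {set T}} => #|\bigcup_i G i|)).
by apply/forallP=> i; rewrite ffunE.
Qed.

Lemma gkf_parameters_exist P : P set0 -> exists a, gkf_parameters P a.
Proof.
move=> P0; exists (fun i => max_cover P i - max_cover P i.-1) => k.
elim: k => [|k IHk]; first by rewrite big_geq ?max_cover0.
by rewrite big_nat_recr //= IHk subnKC ?max_coverS.
Qed.

Lemma gkf_parametersE P a k :
  gkf_parameters P a -> a k.+1 = max_cover P k.+1 - max_cover P k.
Proof. by move=> Pa; rewrite -!Pa big_nat_recr //= addKn. Qed.

(* Hence all products over i may be truncated at i = #|T|. *)
Lemma gkf_parameters_eq0 P a k :
  P set0 -> (forall x, P [set x]) -> gkf_parameters P a -> #|T| < k -> a k = 0.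
Proof.
case: k => // k P0 P1 Pa le_Tk; rewrite (gkf_parametersE _ Pa).
by rewrite !max_cover_full ?subnn // ltnW.
Qed.

End Posets.

(* Main.v *)
(* Write C_k(X) for the maximal size of a union of k antichains (resp. chains)
   inside X, so that a_k = C_k - C_(k-1). Both bounds are proved by deleting one
   element x and inducting on X.

   C_k is concave in k, hence a is weakly decreasing. For antichains this is a
   midpoint argument on the height functions of two families; for chains it is an
   exchange along an alternating path of two partial matchings. Deleting x lowers
   each C_k by d_k(x) = 0 or 1, and for decreasing a this gives
     prod_k a_k! <= (sum_k d_k(x) (a_k - a_(k+1))) * prod_k a'_k!
   for the parameters a' of X without x. No monotonicity of d_k(x) in k is needed.

   Lower bound: e(X) >= sum_(x in A) e(X \ x) for an antichain A; taking A of
   maximal size a_1, each weight above is at most a_1.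
   Upper bound: e(X) = sum of e(X \ x) over minimal x. At most k minimal elements
   have d_k(x) = 1, since they lie in every optimal family of k chains, so the
   weights sum to at most sum_k k (c_k - c_(k+1)) = |X|. *)
Require Import Defs.
From mathcomp Require Import all_boot all_order all_algebra.
From mathcomp Require Import zify.

Set Implicit Arguments.
Unset Strict Implicit.
Unset Printing Implicit Defensive.

Import Order.TTheory GRing.Theory Num.Theory.

(** * Products of factorials of a decreasing sequence under a unit perturbation *)

Section FactorialWeight.

Variables (b : nat -> nat) (d : nat -> bool).
Hypothesis b_anti : forall k, b k.+1 <= b k.

Let G m := \sum_(k < m) d k.+1 * (b k - b k.+1).

(** The sum telescopes once every [d] is bounded by 1. This caps the weight of a deleted element by
    the first parameter. *)
Lemma weight_le m : G m + b m <= b 0.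
Proof.
elim: m => [|m]; first by rewrite /G big_ord0.
rewrite /G big_ord_recr /= -/(G m); have := b_anti m.
by case: (d m.+1); lia.
Qed.

Lemma sum_by_parts m :
  \sum_(k < m) k.+1 * (b k - b k.+1) + m * b m = \sum_(k < m) b k.
Proof.
elim: m => [|m IH]; first by rewrite !big_ord0.
by rewrite !big_ord_recr /= -IH -addnA -mulnDr subnK // mulSnr addnA.
Qed.

Variable b' : nat -> nat.
Hypothesis d0 : d 0 = false.
Hypothesis b_d : forall k, b k + d k = b' k + d k.+1.

Let P m := \prod_(k < m) (b k)`!.
Let P' m := \prod_(k < m) (b' k)`!.

(* [G m + b m] is the sum of the [b k] over the steps where [d] switches on,
   minus the sum over those where it switches off. *)
Lemma prod_fact_perturb_rec m :
  (d m -> P m <= (G m + b m) * P' m) /\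
  (~~ d m -> forall t, t <= b m -> P m * t <= (G m + t) * P' m).
Proof.
elim: m => [|m]; first by rewrite d0 /P /P' /G !big_ord0; split=> // _ t; lia.
have -> : P m.+1 = P m * (b m)`! by rewrite /P big_ord_recr.
have -> : P' m.+1 = P' m * (b' m)`! by rewrite /P' big_ord_recr.
have -> : G m.+1 = G m + d m.+1 * (b m - b m.+1) by rewrite /G big_ord_recr.
have := b_d m; have := b_anti m.
case: (d m) (d m.+1) => [] [] /= le_b; rewrite ?addn0 ?addn1 => eq_b [IH1 IH0];
  split=> // _.
- have -> : b' m = b m by lia.
  rewrite mul1n mulnA leq_mul2r; apply/orP; right.
  have -> : G m + (b m - b m.+1) + b m.+1 = G m + b m by lia.
  exact: IH1.
(* Here [d] switches off and [b' m] exceeds [b m] by one. The extra factor [(b m).+1] replaces [b m]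
   by any smaller [t], left free because the next value where [d] switches on is still unknown. *)
- move=> t le_t; rewrite -eq_b factS ?mul0n ?addn0.
  have := leq_mul (IH1 isT) (leqnn (t * (b m)`!)).
  have : (G m + b m) * t <= (G m + t) * (b m).+1 by nia.
  move/(leq_mul (leqnn (P' m * (b m)`!))); nia.
(* Here [d] switches on, and the surplus factor [b m] of the left factorial is absorbed by taking
   [t = b m]. *)
- rewrite eq_b factS -eq_b.
  have -> : G m + 1 * (b m - b m.+1) + b m.+1 = G m + b m by lia.
  have := leq_mul (IH0 isT _ (leqnn _)) (leqnn (b' m)`!); nia.
- move=> t le_t; rewrite -eq_b ?mul0n ?addn0.
  have := leq_mul (IH0 isT t (leq_trans le_t le_b)) (leqnn (b m)`!); nia.
Qed.

Lemma prod_fact_perturb m : d m -> P m <= (G m + b m) * P' m.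
Proof. by case: (prod_fact_perturb_rec m). Qed.

End FactorialWeight.

(** * Reachability for relations with unique predecessors *)

Section BackwardDeterministic.

Variables (T : finType) (r : rel T).
Hypothesis r_inj : forall x y z, r x z -> r y z -> x = y.

Lemma connect_lastP x z :
  connect r x z -> x = z \/ exists2 y, connect r x y & r y z.
Proof.
case/connectP=> p; case/lastP: p => [|p y] /=; first by left.
rewrite rcons_path last_rcons => /andP [xp ry] ->; right.
by exists (last x p) => //; apply/connectP; exists p.
Qed.

(** Going back from [z] there is only one path, so [x] and [y] both lie on it. *)
Lemma connect_backward_total x y z :
  connect r x z -> connect r y z -> connect r x y || connect r y x.
Proof.
case/connectP=> p; elim/last_ind: p y z => [|p w IH] y z /=.
  by move=> _ -> ->; rewrite orbT.
rewrite rcons_path last_rcons => /andP [xp rw] -> /connect_lastP [->|].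
  apply/orP; left; apply/connectP; exists (rcons p w); rewrite ?last_rcons //.
  by rewrite rcons_path xp.
by case=> v yv /(r_inj rw) e; apply: IH xp erefl _; rewrite e.
Qed.

End BackwardDeterministic.

(** * Covers relative to a subset, effect of deleting a point, and concavity for antichains *)

Section Covers.

Variables (disp : Order.disp_t) (T : finPOrderType disp).
Implicit Types (X Y A C : {set T}) (P : pred {set T}).

(** The families live in [T] and only their trace on [X] is counted, so one family can be reused for
    every subset. *)
Definition cover_in P X k : nat :=
  \max_(F : {ffun 'I_k -> {set T}} | [forall i, P (F i)])
     #|X :&: \bigcup_i F i|.

(** For chains and antichains this is the parameter of index [k.+1] of the subposet [X]: indices
    here start at 0. *)
Definition cover_gain P X k : nat := cover_in P X k.+1 - cover_in P X k.

Lemma cover_in_setT P k : cover_in P [set: T] k = max_cover P k.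
Proof. by apply: eq_bigr => F _; rewrite setTI. Qed.

Lemma cover_in_ge P X k (F : 'I_k -> {set T}) :
  (forall i, P (F i)) -> #|X :&: \bigcup_i F i| <= cover_in P X k.
Proof.
move=> PF; rewrite (eq_bigr (finfun F)) => [|i _]; last by rewrite ffunE.
apply: (leq_bigmax_cond (F := fun F : {ffun _ -> {set T}} =>
  #|X :&: \bigcup_i F i|)).
by apply/forallP=> i; rewrite ffunE.
Qed.

Lemma cover_in_le P X k : cover_in P X k <= #|X|.
Proof. by apply/bigmax_leqP=> F _; apply/subset_leq_card/subsetIl. Qed.

Lemma cover_in0 P X : cover_in P X 0 = 0.
Proof.
apply/eqP; rewrite -leqn0; apply/bigmax_leqP=> F _.
by rewrite big_ord0 setI0 cards0.
Qed.

Lemma cover_inS X Y P k : X \subset Y -> cover_in P X k <= cover_in P Y k.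
Proof.
move=> sXY; apply/bigmax_leqP=> F /forallP PF.
apply: leq_trans (cover_in_ge Y PF).
by apply/subset_leq_card/setSI.
Qed.

Lemma cover_in_witness P X k : P set0 ->
  exists2 F : 'I_k -> {set T},
    forall i, P (F i) & cover_in P X k = #|X :&: \bigcup_i F i|.
Proof.
move=> P0; have [|F PF eF] := @eq_bigmax_cond _
  [pred F : {ffun 'I_k -> {set T}} | [forall i, P (F i)]]
  (fun F => #|X :&: \bigcup_i F i|).
  by apply/card_gt0P; exists [ffun=> set0]; apply/forallP=> i; rewrite ffunE.
by exists F; [exact/forallP | exact: eF].
Qed.

Lemma cover_in_leS P X k : P set0 -> cover_in P X k <= cover_in P X k.+1.
Proof.
move=> P0; have [F PF ->] := cover_in_witness X k P0.
pose G (i : 'I_k.+1) := if unlift ord0 i is Some j then F j else set0.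
have -> : \bigcup_i F i = \bigcup_i G i.
  rewrite big_ord_recl /G unlift_none set0U.
  by apply: eq_bigr => i _; rewrite liftK.
by apply: cover_in_ge => i; rewrite /G; case: (unlift _ _).
Qed.

Lemma cover_inD1 P X x k : P set0 ->
  cover_in P X k <= (cover_in P (X :\ x) k).+1.
Proof.
move=> P0; have [F PF ->] := cover_in_witness X k P0.
have := cover_in_ge (X :\ x) PF; rewrite -ltnS; apply: leq_trans.
by rewrite setIDAC (cardsD1 x (_ :&: _)) -add1n leq_add2r leq_b1.
Qed.

Lemma cover_in_full P X k : P set0 -> (forall x, P [set x]) -> #|T| <= k ->
  cover_in P X k = #|X|.
Proof.
move=> P0 P1 le_Tk; have [F PF] := cover_in_witness [set: T] k P0.
rewrite cover_in_setT max_cover_full // -cardsT setTI => eT.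
have FT : \bigcup_i F i = setT.
  by apply/eqP; rewrite eqEcard subsetT -eT leqnn.
apply/eqP; rewrite eqn_leq cover_in_le /=.
by apply: leq_trans (cover_in_ge X PF); rewrite FT setIT.
Qed.

Lemma sum_cover_gain P X k : P set0 ->
  \sum_(i < k) cover_gain P X i = cover_in P X k.
Proof.
move=> P0; elim: k => [|k IH]; first by rewrite big_ord0 cover_in0.
by rewrite big_ord_recr /= IH subnKC ?cover_in_leS.
Qed.

Lemma chain_antichain_card A C : is_chain C -> is_antichain A ->
  #|C :&: A| <= 1.
Proof.
move=> /forall_inP cC /forall_inP aA; apply/card_le1_eqP=> x y.
rewrite !inE => /andP [Cx Ax] /andP [Cy Ay].
apply/eqP/negPn/negP; rewrite eq_sym => nxy.
have /forall_inP/(_ y Cy) := cC x Cx.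
by have /forall_inP/(_ y Ay)/implyP/(_ nxy)/negPf -> := aA x Ax.
Qed.

Lemma antichain_ltF A x y : is_antichain A -> x \in A -> y \in A ->
  (x < y)%O = false.
Proof.
move=> /forall_inP/(_ x) aA Ax Ay; apply/negP=> xy.
have /forall_inP/(_ y Ay)/implyP := aA Ax.
by rewrite (lt_eqF xy) => /(_ isT); rewrite /= (lt_comparable xy).
Qed.

Lemma is_antichainP A :
  reflect {in A &, forall x y, (x < y)%O = false} (is_antichain A).
Proof.
apply: (iffP idP) => [aA x y|ltF]; first exact: antichain_ltF.
apply/forall_inP=> x Ax; apply/forall_inP=> y Ay; apply/implyP=> nxy.
apply/negP=> /orP [] le_xy.
  by move: (ltF x y Ax Ay); rewrite lt_neqAle nxy le_xy.
by move: (ltF y x Ay Ax); rewrite lt_neqAle eq_sym nxy le_xy.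
Qed.

Section Perturbation.

Variable P : pred {set T}.
Hypotheses (P0 : P set0) (P1 : forall x, P [set x]).
Hypothesis cover_concave :
  forall X k, cover_in P X k + cover_in P X k.+2 <= (cover_in P X k.+1).*2.

(** The number d_k(x); a boolean suffices because deleting one point costs at most one. *)
Definition cover_drop X x k : bool := cover_in P (X :\ x) k < cover_in P X k.

Lemma cover_gain_anti X k : cover_gain P X k.+1 <= cover_gain P X k.
Proof.
rewrite /cover_gain; have := cover_concave X k.
have := cover_in_leS X k P0; have := cover_in_leS X k.+1 P0; lia.
Qed.

Lemma cover_gain_full X : cover_gain P X #|T| = 0.
Proof. by rewrite /cover_gain !cover_in_full ?subnn. Qed.

(** Subtract the decompositions of [cover_in P X] at [k] and [k.+1] as its value on [X :\ x] plus
    the drop. *)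
Let gain_drop X x k :
  cover_gain P X k + cover_drop X x k =
  cover_gain P (X :\ x) k + cover_drop X x k.+1.
Proof.
rewrite /cover_gain /cover_drop.
have := cover_in_leS X k P0; have := cover_in_leS (X :\ x) k P0.
have := cover_inD1 X x k P0; have := cover_inD1 X x k.+1 P0.
have := cover_inS P k (subD1set X x); have := cover_inS P k.+1 (subD1set X x).
by case: ltnP; case: ltnP; lia.
Qed.

Let drop0 X x : cover_drop X x 0 = false.
Proof. by rewrite /cover_drop !cover_in0. Qed.

Lemma prod_cover_gainD1 X x : x \in X ->
  \prod_(k < #|T|) (cover_gain P X k)`! <=
  (\sum_(k < #|T|) cover_drop X x k.+1 *
     (cover_gain P X k - cover_gain P X k.+1)) *
  \prod_(k < #|T|) (cover_gain P (X :\ x) k)`!.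
Proof.
move=> Xx.
have := prod_fact_perturb (cover_gain_anti X) (drop0 X x) (gain_drop X x).
(* With [#|T|] sets everything is covered: the boundary gain is 0 and the drop at [x] is 1. *)
move/(_ #|T|); rewrite cover_gain_full addn0; apply.
by rewrite /cover_drop !cover_in_full // [X in _ < X](cardsD1 x) Xx.
Qed.

Lemma prod_cover_gainD1_le X x : x \in X ->
  \prod_(k < #|T|) (cover_gain P X k)`! <=
  cover_in P X 1 * \prod_(k < #|T|) (cover_gain P (X :\ x) k)`!.
Proof.
move=> Xx; apply: leq_trans (prod_cover_gainD1 Xx) _.
rewrite leq_mul2r; apply/orP; right.
have := weight_le (cover_drop X x) (cover_gain_anti X) #|T|.
by rewrite cover_gain_full addn0 {3}/cover_gain cover_in0 subn0.
Qed.

End Perturbation.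


(** Serves both for a chain covered by antichains and for an antichain covered by chains. *)
Lemma card_transversal_le k (F : 'I_k -> {set T}) C :
  (forall i, #|C :&: F i| <= 1) -> C \subset \bigcup_i F i -> #|C| <= k.
Proof.
move=> le1 /setIidPl <-; rewrite big_distrr /=.
apply: (@leq_trans (\sum_(i < k) #|C :&: F i|)).
  elim/big_ind2: _ => [|A1 n1 A2 n2 leA1 leA2|i _]; rewrite ?cards0 //.
  by rewrite cardsU; apply: leq_trans (leq_subr _ _) _; exact: leq_add.
by rewrite -[leqRHS](card_ord k) -sum1_card leq_sum.
Qed.

Lemma card_setIE X A : #|X :&: A| = \sum_(x in X) (x \in A).
Proof.
rewrite -sum1_card big_mkcond [RHS]big_mkcond /=; apply: eq_bigr => x _.
by rewrite inE; case: (x \in X); case: (x \in A).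
Qed.

(** Summing the heights in the two unions gives each point an integer interval inside [0, 2(k+1)),
    at least as long as the number of unions containing it. Intervals of comparable points follow
    each other. Halving the levels, rounding down and then up, yields two families of [k.+1]
    antichains. *)
Lemma antichain_cover_concave X k :
  cover_in (@is_antichain _ T) X k + cover_in (@is_antichain _ T) X k.+2
    <= (cover_in (@is_antichain _ T) X k.+1).*2.
Proof.
have [F aF ->] := cover_in_witness X k (@is_antichain0 _ T).
have [H aH ->] := cover_in_witness X k.+2 (@is_antichain0 _ T).
set U := \bigcup_i F i; set V := \bigcup_i H i.
(* Used with [<] and [<=]: the heights just before and just after [x], which differ by at least one
   when [x] is in [W]. *)
pose h (R : rel T) (W : {set T}) x :=
  \max_(C : {set T} | is_chain C && (C \subset [set y in W | R y x])) #|C|.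
have h_le_card j (E : 'I_j -> {set T}) R x :
    (forall i, is_antichain (E i)) -> h R (\bigcup_i E i) x <= j.
  move=> aE; apply/bigmax_leqP=> C /andP [cC sC].
  apply: card_transversal_le (fun i => chain_antichain_card cC (aE i)) _.
  apply: subset_trans sC _.
  by apply/subsetP=> y; rewrite inE => /andP [].
have h_mono (R R' : rel T) W x y :
    (forall z, R z x -> R' z y) -> h R W x <= h R' W y.
  move=> sR; apply/bigmax_leqP=> C /andP [cC /subsetP sC].
  apply: (leq_bigmax_cond (F := fun C : {set T} => #|C|)).
  rewrite cC; apply/subsetP=> z /sC; rewrite !inE => /andP [-> /=]; exact: sR.
have h_lt W x : h <%O W x + (x \in W) <= h <=%O W x.
  case Wx: (x \in W); last by rewrite addn0; apply: h_mono => z /ltW.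
  have : 0 < #|[pred C : {set T} | is_chain C &&
                  (C \subset [set y in W | (y < x)%O])]|.
    by apply/card_gt0P; exists set0; rewrite inE is_chain0 sub0set.
  case/(eq_bigmax_cond (fun C => #|C|)) => C.
  case/andP=> /forall_inP cC /subsetP sC eC.
  have -> : h <%O W x = #|C| by exact: eC.
  have ltC z : z \in C -> (z < x)%O by move/sC; rewrite inE => /andP [].
  have -> : #|C| + true = #|x |: C|.
    rewrite cardsU1 addnC; congr (_ + _); apply/esym/eqP; rewrite eqb1.
    by apply/negP=> /ltC; rewrite ltxx.
  apply: (leq_bigmax_cond (F := fun C : {set T} => #|C|)).
  apply/andP; split.
    apply/forall_inP=> y /setU1P [->|Cy]; apply/forall_inP=> z /setU1P [->|Cz].
    - exact: comparablexx.
    - by rewrite gt_comparable ?ltC.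
    - by rewrite lt_comparable ?ltC.
    - by have /forall_inP/(_ z Cz) := cC y Cy.
  apply/subsetP=> z /setU1P [->|Cz]; first by rewrite inE Wx lexx.
  by have := sC z Cz; rewrite !inE => /andP [-> /ltW].
(* The interval of [x] runs from [hi x], included, to [ho x], excluded. *)
pose hi x := h <%O U x + h <%O V x; pose ho x := h <=%O U x + h <=%O V x.
have hio x : hi x + (x \in U) + (x \in V) <= ho x.
  by rewrite /hi /ho; have := h_lt U x; have := h_lt V x; lia.
have hoi x y : (x < y)%O -> ho x <= hi y.
  by move=> xy; apply: leq_add; apply: h_mono => z /le_lt_trans; apply.
have ho_le x : ho x <= (k.+1).*2.
  have := h_le_card _ F <=%O x aF; have := h_le_card _ H <=%O x aH.
  by rewrite -/U -/V /ho -addnn addSn addnS; lia.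
(* A point whose interval survives the rounding [r] is put at level [r (hi x)]. Points of one level
   are incomparable, since [x < y] forces [r (hi x) < r (ho x) <= r (hi y)]. *)
have level (r : nat -> nat) : {homo r : m n / m <= n} -> r (k.+1).*2 <= k.+1 ->
    exists2 E : 'I_k.+1 -> {set T}, forall i, is_antichain (E i) &
      forall x, (x \in \bigcup_i E i) = (r (hi x) < r (ho x)).
  move=> r_mono r_le.
  exists (fun i : 'I_k.+1 =>
    [set x | (r (hi x) == i) && (r (hi x) < r (ho x))]).
    move=> i; apply/is_antichainP=> x y.
    rewrite !inE => /andP [/eqP <- lt_x] /andP [/eqP ey _]; apply/negP=> xy.
    by have := leq_trans lt_x (r_mono _ _ (hoi _ _ xy)); rewrite ey ltnn.
  move=> x; apply/bigcupP/idP=> [[i _]|lt_x]; first by rewrite inE => /andP [].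
  have lt_k := leq_trans lt_x (leq_trans (r_mono _ _ (ho_le x)) r_le).
  by exists (Ordinal lt_k); rewrite // inE eqxx.
have [|E1 aE1 inE1] := level half half_leq; first by rewrite doubleK.
have [|E2 aE2 inE2] := level uphalf uphalf_leq; first by rewrite uphalf_double.
have := leq_add (cover_in_ge X aE1) (cover_in_ge X aE2).
rewrite -addnn; apply: leq_trans.
rewrite !card_setIE -!big_split /=; apply: leq_sum => x _.
(* [half] detects an odd integer in the interval and [uphalf] an even one; an interval of length 2
   contains both. *)
rewrite inE1 inE2; have := hio x.
case: (x \in U); case: (x \in V); case: ltnP; case: ltnP => //=; lia.
Qed.

End Covers.

(** * Chain families as partial matchings, and concavity for chains *)

Section ChainConcavity.

Variables (disp : Order.disp_t) (T : finPOrderType disp).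
Implicit Types (X Y A C : {set T}) (f g : {ffun T -> option T}).

(* A family of disjoint chains is encoded by the partial map sending each
   covered element to the next one in its chain, the last element of a chain to
   [None] and each uncovered element to itself. *)
Definition linking f : Prop :=
  (forall x y, f x = Some y -> (x <= y)%O) /\
  (forall x y z, f x = Some z -> f y = Some z -> x = y).

Definition chain_ends f := [set x | f x == None].

Definition linked f := [set x | f x != Some x].

(** Overlaps are removed by assigning each covered point to one chain containing it; [f] is then the
    successor inside that class, and each nonempty class has one end. *)
Lemma chain_cover_linking k (F : 'I_k -> {set T}) :
  (forall i, is_chain (F i)) ->
  exists f, [/\ linking f, #|chain_ends f| <= k
              & \bigcup_i F i \subset linked f].
Proof.
move=> cF; pose idx x := [pick i | x \in F i].
have idx_chain x y : idx x != None -> idx x == idx y -> (x >=< y)%O.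
  rewrite /idx; case: pickP => // i Fx _; case: pickP => // j Fy /eqP [eij].
  by have /forall_inP/(_ x Fx)/forall_inP := cF i; apply; rewrite eij.
pose next x := [pred y | [&& idx y == idx x, (x < y)%O &
  [forall z, (idx z == idx x) && (x < z)%O ==> (y <= z)%O]]].
pose f := [ffun x => if idx x is None then Some x else [pick y | next x y]].
have fP x y : f x = Some y ->
    idx x = None /\ x = y \/ idx x != None /\ next x y.
  rewrite ffunE; case: (idx x) (erefl (idx x)) => [i|] ex; last first.
    by case=> ->; left.
  by case: pickP => // z nz [<-]; right.
have idx_f x y : f x = Some y -> idx x = idx y.
  by case/fP=> [[_ ->] //|[_ /and3P [/eqP ->]]].
exists f; split.
- split=> [x y /fP [[_ ->] //|[_ /and3P [_ /ltW]]] //|x y z fx fy].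
  have := idx_f _ _ fx; rewrite -(idx_f _ _ fy) => exy.
  case/fP: fx => [[xN ->]|[xS /and3P [_ xz /forallP/(_ y) minx]]].
    by case/fP: fy => [[_ ->] //|[]]; rewrite -exy xN.
  case/fP: fy => [[]|[_ /and3P [_ yz /forallP/(_ x) miny]]].
    by rewrite -exy => xN; rewrite xN in xS.
  have := idx_chain x y xS; rewrite exy eqxx => /(_ isT).
  case: (comparableP x y) => // ltxy _.
    by move: minx => /=; rewrite exy eqxx ltxy /= => /le_gtF; rewrite yz.
  by move: miny => /=; rewrite exy eqxx ltxy /= => /le_gtF; rewrite xz.
- have endP x : x \in chain_ends f -> exists2 i, idx x = Some i &
      forall z, idx z = Some i -> (x < z)%O = false.
    rewrite inE ffunE; case ex: (idx x) => [i|] // noN; exists i => // z ez.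
    apply/negP=> xz.
    pose B := [pred z | (idx z == Some i) && (x < z)%O].
    have Bz : B z by rewrite inE /= ez eqxx.
    (* The least point of the class above [x] is found by minimizing the number of points below
       it. *)
    have [y /andP [/eqP ey xy] miny] :=
      @arg_minnP _ z B (fun y => #|[set w | (w < y)%O]|) Bz.
    move: noN; case: pickP => // /(_ y) /negP []; apply/and3P; split=> //.
      by rewrite ey ex.
    apply/forallP=> w; apply/implyP; rewrite ex => /andP [ew xw].
    have := idx_chain y w; rewrite ey (eqP ew) eqxx => /(_ isT isT).
    case: (comparableP y w) => // ltwy _.
    have := miny w; rewrite inE /= ew xw => /(_ isT); rewrite leqNgt.
    case/negP; apply/proper_card/properP; split.
      by apply/subsetP=> v; rewrite !inE => /lt_trans; apply.
    by exists w; rewrite !inE ?ltxx.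
  case: (pickP (mem (chain_ends f))) => [x1 /endP [i0 _ _]|nE]; last first.
    by rewrite (eq_card0 nE).
  rewrite -[leqRHS](card_ord k).
  rewrite -(card_in_imset (f := fun x => odflt i0 (idx x))) ?max_card //.
  move=> x y /endP [i ex mx] /endP [j ey my]; rewrite ex ey /= => eij; subst j.
  have := idx_chain x y; rewrite ex ey eqxx => /(_ isT isT).
  by case: (comparableP x y) => //; rewrite ?mx ?my.
- apply/subsetP=> x /bigcupP [i _ Fx]; rewrite inE; apply/eqP=> /fP [[xN _]|].
    by move: xN; rewrite /idx; case: pickP => // /(_ i); rewrite Fx.
  by case=> _ /and3P []; rewrite ltxx.
Qed.

(** Iterating [f] from a linked point climbs strictly until it meets an end; the points that reach a
    given end form a chain. *)
Lemma linking_chain_cover k f : linking f -> #|chain_ends f| <= k ->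
  exists2 F : 'I_k -> {set T},
    forall i, is_chain (F i) & linked f \subset \bigcup_i F i.
Proof.
case=> f_le f_inj le_k; pose r := [rel x y | f x == Some y].
have r_inj x y z : r x z -> r y z -> x = y.
  by move=> /eqP xz /eqP; apply: f_inj.
have r_le x y : connect r x y -> (x <= y)%O.
  case/connectP=> p; elim: p x => [|z p IH] x /=; first by move=> _ ->.
  by case/andP=> /eqP /f_le xz zp /(IH _ zp); apply: le_trans.
pose chain_to e := [set x | connect r x e].
have chain_toP e : is_chain (chain_to e).
  apply/forall_inP=> x; rewrite inE => xe.
  apply/forall_inP=> y; rewrite inE => ye.
  by case/orP: (connect_backward_total r_inj xe ye) => /r_le;
    [exact: le_comparable | exact: ge_comparable].
have reach x : f x != Some x -> exists2 e, connect r x e & e \in chain_ends f.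
  have [n] := ubnP #|[set z | (x < z)%O]|.
  elim: n x => // n IH x lt_n nx; case fx: (f x) => [y|]; last first.
    by exists x; rewrite ?inE ?fx.
  have nxy : x != y by apply: contraNneq nx => exy; rewrite fx exy.
  have xy : (x < y)%O by rewrite lt_neqAle nxy f_le.
  have [||e ye eE] := IH y.
  - rewrite -ltnS; apply: leq_trans lt_n; rewrite ltnS.
    apply/proper_card/properP; split; last by exists y; rewrite !inE ?ltxx.
    by apply/subsetP=> z; rewrite !inE; apply: lt_trans.
  - by apply: contraNneq nxy => fy; rewrite (f_inj _ _ _ fx fy).
  exists e => //; apply: connect_trans ye; apply: connect1.
  by rewrite /r /= fx.
(* There may be fewer than [k] ends; the default [None] pads the family with empty chains. *)
exists (fun i => if nth None (map Some (enum (chain_ends f))) i is Some e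
                 then chain_to e else set0).
  by move=> i; case: (nth _ _ _) => [e|]; rewrite ?is_chain0.
apply/subsetP=> x; rewrite inE => /reach [e xe eE]; apply/bigcupP.
have eI : e \in enum (chain_ends f) by rewrite mem_enum.
have lt_k : index e (enum (chain_ends f)) < k.
  by apply: leq_trans le_k; rewrite cardE index_mem.
exists (Ordinal lt_k) => //=.
by rewrite (nth_map e) ?index_mem // nth_index // inE.
Qed.

(* Exchanging [f] and [g] along an alternating path that starts at an end of [f]
   and does not finish at an end of [g]. *)
Lemma linking_exchange f g : linking f -> linking g ->
    #|chain_ends g| < #|chain_ends f| ->
  exists f' g', [/\ linking f', linking g',
    #|chain_ends f'| = #|chain_ends f|.-1, #|chain_ends g'| = #|chain_ends g|.+1
    & forall x, (x \in linked f') + (x \in linked g') =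
                (x \in linked f) + (x \in linked g)].
Proof.
move=> [f_le f_inj] [g_le g_inj] lt_gf.
(* One step of the alternating path: forward along [g], then back along [f]. *)
pose r := [rel x y | (g x != None) && (g x == f y)].
have r_inj x y z : r x z -> r y z -> x = y.
  rewrite /r /=; case gx: (g x) => [w|] //= /eqP ew /andP [_ /eqP ey].
  by apply: g_inj gx _; rewrite ey.
have r_end x u : f u = None -> connect r x u -> x = u.
  by move=> fu /connect_lastP [//|[y _ /andP [ny /eqP]]]; rewrite fu => e;
    rewrite e in ny.
have [u [fu gu uK]] : exists u, [/\ f u = None, g u != None &
    forall x, connect r u x -> g x != None].
  (* If every path from [D] finished at an end of [g], its final point would inject [D] into the
     smaller set [E]. *)
  pose D := chain_ends f :\: chain_ends g.
  pose E := chain_ends g :\: chain_ends f.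
  case: (pickP [pred u in D | [forall x, connect r u x ==> (g x != None)]]).
    move=> u /andP []; rewrite !inE => /andP [gu /eqP fu] /forallP uK.
    by exists u; split=> // x; exact/implyP.
  move=> noD; have lt_ED : #|E| < #|D|.
    move: lt_gf; rewrite -(cardsID (chain_ends f) (chain_ends g)).
    by rewrite -(cardsID (chain_ends g) (chain_ends f)) setIC ltn_add2l.
  have endD u : u \in D -> exists x, connect r u x && (g x == None).
    move=> Du; have := noD u; rewrite /= Du /= => /negbT; rewrite negb_forall.
    by case/existsP=> x; rewrite negb_imply negbK; exists x.
  pose w u := odflt u [pick x | connect r u x && (g x == None)].
  have wP u : u \in D -> connect r u (w u) /\ g (w u) = None.
    rewrite /w => Du; case: pickP => [x /andP [ux /eqP] //|].
    by have [x ux] := endD u Du; move/(_ x); rewrite ux.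
  have w_inj : {in D &, injective w}.
    move=> u v Du Dv; have [[uw _] [vw _]] := (wP u Du, wP v Dv) => ew.
    rewrite -ew in vw.
    move: Du Dv; rewrite !inE => /andP [_ /eqP fu] /andP [_ /eqP fv].
    by case/orP: (connect_backward_total r_inj uw vw) => /r_end ->.
  suff : #|w @: D| <= #|E| by rewrite card_in_imset // leqNgt lt_ED.
  apply/subset_leq_card/subsetP=> _ /imsetP [u Du ->].
  have [uw gw] := wP u Du; rewrite !inE gw eqxx andbT.
  apply/eqP=> fw; have euw := r_end _ _ fw uw.
  by move: Du; rewrite !inE {1}euw gw.
pose K := [set x | connect r u x].
have uinK : u \in K by rewrite inE connect0.
have Kr x y : x \in K -> r x y -> y \in K.
  move=> Kx xy; have := connect1 (e := r) xy.
  by move: Kx; rewrite !inE; apply: connect_trans.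
have Kf x : x \in K -> x = u \/ exists2 y, y \in K & r y x.
  rewrite inE => /connect_lastP [->|[y uy yx]]; [by left | right].
  by exists y; rewrite ?inE.
(* Swap along the path [K]. It is closed under [r], and under predecessors except at [u], where
   [f u = None], so no collision arises between [K] and its complement. *)
pose f' := [ffun x => if x \in K then g x else f x].
pose g' := [ffun x => if x \in K then f x else g x].
have fgK x y z : x \in K -> g x = Some z -> f y = Some z -> y \in K.
  by move=> Kx gx fy; apply: Kr Kx _; rewrite /r /= gx fy eqxx.
have gfK x y z : x \in K -> f x = Some z -> g y = Some z -> y \in K.
  move=> Kx fx gy; case: (Kf x Kx) => [exu|[v Kv]].
    by rewrite exu fu in fx.
  rewrite /r /= fx => /andP [_ /eqP gv].
  by rewrite (g_inj _ _ _ gy gv).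
exists f', g'; split.
- split=> [x y|x y z]; rewrite !ffunE.
    by case: ifP => _; [apply: g_le | apply: f_le].
  case: ifP => Kx; case: ifP => Ky; [exact: g_inj | | | exact: f_inj] => e1 e2.
    by rewrite (fgK _ _ _ Kx e1 e2) in Ky.
  by rewrite (fgK _ _ _ Ky e2 e1) in Kx.
- split=> [x y|x y z]; rewrite !ffunE.
    by case: ifP => _; [apply: f_le | apply: g_le].
  case: ifP => Kx; case: ifP => Ky; [exact: f_inj | | | exact: g_inj] => e1 e2.
    by rewrite (gfK _ _ _ Kx e1 e2) in Ky.
  by rewrite (gfK _ _ _ Ky e2 e1) in Kx.
- have -> : chain_ends f' = chain_ends f :\ u.
    apply/setP=> x; rewrite !inE ffunE; case: ifP => Kx.
      have gx : g x != None by apply: uK; rewrite inE in Kx.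
      rewrite (negPf gx); case: (Kf x Kx) => [->|[y _ /andP [ny /eqP <-]]].
        by rewrite eqxx.
      by rewrite (negPf ny) andbF.
    by case: (x =P u) => // exu; rewrite exu uinK in Kx.
  by rewrite [in RHS](cardsD1 u) inE fu eqxx.
- have -> : chain_ends g' = u |: chain_ends g.
    apply/setP=> x; rewrite !inE ffunE; case: ifP => Kx.
      have gx : g x != None by apply: uK; rewrite inE in Kx.
      rewrite (negPf gx) orbF; case: (Kf x Kx) => [->|[y _ /andP [ny /eqP e]]].
        by rewrite fu !eqxx.
      rewrite -e (negPf ny); apply/esym/eqP=> exu.
      by move: ny; rewrite e exu fu.
    by case: (x =P u) => // exu; rewrite exu uinK in Kx.
  by rewrite cardsU1 inE gu.
- move=> x; rewrite !inE !ffunE; case: ifP => // _; exact: addnC.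
Qed.

(** If the larger family has [k.+2] ends, one exchange moves an end to the smaller one and keeps the
    total coverage; both then fit in [k.+1] chains. *)
Lemma chain_cover_concave X k :
  cover_in (@is_chain _ T) X k + cover_in (@is_chain _ T) X k.+2
    <= (cover_in (@is_chain _ T) X k.+1).*2.
Proof.
have [G cG ->] := cover_in_witness X k (@is_chain0 _ T).
have [F cF ->] := cover_in_witness X k.+2 (@is_chain0 _ T).
have [g [lg gk sg]] := chain_cover_linking cG.
have [f [lf fk sf]] := chain_cover_linking cF.
have leG : #|X :&: \bigcup_i G i| <= #|X :&: linked g|.
  by apply/subset_leq_card/setIS.
have leF : #|X :&: \bigcup_i F i| <= #|X :&: linked f|.
  by apply/subset_leq_card/setIS.
have main h : linking h -> #|chain_ends h| <= k.+1 ->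
    #|X :&: linked h| <= cover_in (@is_chain _ T) X k.+1.
  move=> lh hk; have [E cE sE] := linking_chain_cover lh hk.
  by apply: leq_trans (cover_in_ge X cE); apply/subset_leq_card/setIS.
apply: leq_trans (leq_add leG leF) _; rewrite -addnn.
case: (leqP #|chain_ends f| k.+1) => fk1.
  by apply: leq_add; apply: main => //; apply: leqW.
have [|f' [g' [lf' lg' ef' eg' efg]]] := linking_exchange lf lg.
  by apply: leq_ltn_trans gk _; apply: ltnW.
suff -> : #|X :&: linked g| + #|X :&: linked f| =
          #|X :&: linked g'| + #|X :&: linked f'|.
  by apply: leq_add; apply: main; rewrite // ?ef' ?eg' //; lia.
rewrite !card_setIE -!big_split /=; apply: eq_bigr => x _.
by rewrite addnC -efg addnC.
Qed.

End ChainConcavity.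

(** * Counting linear extensions by deleting minimal elements *)

Section LinearExtensions.

Variables (disp : Order.disp_t) (T : finPOrderType disp).
Implicit Types (X Y A B C : {set T}).

Definition minimals X := [set x in X | [forall y in X, ~~ (y < x)%O]].

Lemma minimalsP X x :
  reflect (x \in X /\ forall y, y \in X -> (y < x)%O = false)
          (x \in minimals X).
Proof.
rewrite inE.
apply: (iffP andP) => [[Xx /forall_inP minx]|[Xx minx]]; split=> //.
  by move=> y /minx /negPf.
by apply/forall_inP=> y /minx ->.
Qed.

Lemma minimals_sub X : {subset minimals X <= X}.
Proof. by move=> x /minimalsP []. Qed.

Lemma minimals_antichain X : is_antichain (minimals X).
Proof.
apply/is_antichainP=> x y /minimalsP [Xx _] /minimalsP [_ miny]; exact: miny.
Qed.

(** The sum ranges over the first element of the extension; [n] is fuel, to be taken equal to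
    [#|X|]. *)
Fixpoint ext_count_rec n X : nat :=
  if n is n'.+1 then \sum_(x in minimals X) ext_count_rec n' (X :\ x) else 1.

Definition ext_count X := ext_count_rec #|X| X.

Lemma ext_count0 : ext_count set0 = 1.
Proof. by rewrite /ext_count cards0. Qed.

Lemma ext_countE X : X != set0 ->
  ext_count X = \sum_(x in minimals X) ext_count (X :\ x).
Proof.
rewrite -card_gt0 /ext_count; case eX: #|X| => [|n] // _ /=.
apply: eq_bigr => x /minimals_sub Xx; congr ext_count_rec.
by move: eX; rewrite (cardsD1 x) Xx => -[].
Qed.

Lemma sum_le_subset A B (F : T -> nat) : A \subset B ->
  \sum_(x in A) F x <= \sum_(x in B) F x.
Proof.
move=> /subsetP sAB; rewrite big_mkcond [leqRHS]big_mkcond /=.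
by apply: leq_sum => x _; case: ifP => // /sAB ->.
Qed.

(* In the inductive step, the antichain used in [X :\ m] for [m] minimal in [X]
   is [A], except that if [m] lies in [A] then [m] is replaced by the
   elements that become minimal when [m] is removed. *)
Lemma sum_ext_count_antichain X A : is_antichain A -> A \subset X ->
  \sum_(x in A) ext_count (X :\ x) <= ext_count X.
Proof.
have [n] := ubnP #|X|; elim: n X A => // n IH X A lt_n aA sAX.
have [X0|X0] := eqVneq X set0.
  by move: sAX; rewrite X0 subset0 => /eqP ->; rewrite big_set0.
have [sAm|/subsetPn [a Aa na]] := boolP (A \subset minimals X).
  by rewrite ext_countE // sum_le_subset.
(* The non-minimal [a] has a point below it, so [X] has two points and can be expanded twice. *)
have X2 x : X :\ x != set0.
  apply: contraNneq na => X1; have Xa := subsetP sAX a Aa.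
  apply/minimalsP; split=> // y Xy; have: y \notin X :\ x by rewrite X1 inE.
  have: a \notin X :\ x by rewrite X1 inE.
  by rewrite !inE Xy Xa !andbT !negbK => /eqP -> /eqP ->; rewrite ltxx.
pose new x := minimals (X :\ x) :\: minimals X.
have newP z w : w \in new z -> (z < w)%O.
  rewrite inE => /andP [nw /minimalsP [/setD1P [_ Xw] minw]].
  apply: contraNT nw => nzw; apply/minimalsP; split=> // y Xy.
  have [->|nyz] := eqVneq y z; first exact: negPf.
  by apply: minw; rewrite !inE nyz.
have minE z : minimals (X :\ z) = (minimals X :\ z) :|: new z.
  apply/setP=> w; rewrite in_setU in_setD1 [w \in new z]in_setD.
  have [wz|nwz] /= := boolP (w \in minimals (X :\ z)); last first.
    rewrite andbF orbF; apply/esym/negP; case/andP=> wz /minimalsP [Xw minw].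
    case/negP: nwz; apply/minimalsP; split; first by rewrite !inE wz.
    by move=> y /setD1P [_]; apply: minw.
  have /setD1P [nwz _] := minimals_sub wz.
  by rewrite andbT nwz /=; case: (w \in minimals X).
pose e z m := ext_count (X :\ z :\ m).
have split_sum z (B : {set T}) : B :&: new z = set0 ->
    \sum_(m in (B :\ z) :|: new z) e z m =
    \sum_(m in B | m != z) e z m + \sum_(m in new z) e z m.
  move=> dB; rewrite (eq_bigl [predU B :\ z & new z]) => [|m]; last first.
    by rewrite in_setU.
  rewrite bigU /=; last first.
    rewrite -setI_eq0 -subset0 -dB; apply: setSI; exact: subD1set.
  by congr (_ + _); apply: eq_bigl => m; rewrite in_setD1 andbC.
have minI z : minimals X :&: new z = set0.
  by apply/setP=> x; rewrite in_setI in_setD in_set0; case: (x \in minimals X).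
have expand z : z \in A -> ext_count (X :\ z) =
    \sum_(m in minimals X | m != z) e z m +
    (if z \in minimals X then \sum_(m in new z) e z m else 0).
  move=> Az; rewrite ext_countE // minE split_sum //; congr (_ + _).
  (* Deleting a non-minimal [z] makes nothing minimal: a point below [z] stays below everything
     above [z]. *)
  case: ifP => // nz; rewrite big_pred0 // => w; apply/negP=> wz.
  have zw := newP _ _ wz; case/negP: (negbT nz); apply/minimalsP.
  split; first exact: (subsetP sAX).
  move=> y Xy; apply/negP=> yz.
  move: wz; rewrite inE => /andP [_ /minimalsP [_ /(_ y)]].
  by rewrite !inE (lt_eqF yz) Xy (lt_trans yz zw) => /(_ isT).
rewrite (eq_bigr _ expand) big_split /= -big_mkcondr /=.
rewrite [leqRHS]ext_countE //.
(* Regroup the double deletions by the minimal point [m], to compare with [ext_count (X :\ m)]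
   termwise. *)
apply: (@leq_trans (\sum_(m in minimals X)
   (\sum_(z in A | z != m) e z m +
    if m \in A then \sum_(z in new m) e m z else 0))).
  rewrite big_split /= -big_mkcondr /= leq_add //.
    by rewrite (exchange_big_dep (mem (minimals X))) /= => [|z m _ /andP []] //;
      apply: eq_leq; apply: eq_bigr => m Xm; apply: eq_bigl => z;
      rewrite Xm eq_sym.
  by apply: eq_leq; apply: eq_bigl => x; rewrite andbC.
apply: leq_sum => m mX; have /minimalsP [Xm minm] := mX.
have lt_m : #|X :\ m| < n by move: lt_n; rewrite (cardsD1 m) Xm.
have sum_sym : \sum_(z in A | z != m) e z m = \sum_(z in A | z != m) e m z.
  by apply: eq_bigr => z _; rewrite /e !setDDl setUC.
rewrite sum_sym; case: ifP => Am; last first.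
  rewrite addn0; apply: leq_trans (IH (X :\ m) A lt_m aA _); last first.
    by rewrite subsetD1 sAX Am.
  by apply: eq_leq; apply: eq_bigl => z; rewrite andb_idr // => Az;
    apply: contraFneq Am => <-.
have dA : A :&: new m = set0.
  apply/setP=> z; rewrite !in_set0; apply/negP=> /setIP [Az /newP mz].
  by rewrite (antichain_ltF aA) in mz.
rewrite -split_sum //; apply: IH => //; last first.
  apply/subsetP=> z /setUP [/setD1P [nz Az]|].
    by rewrite !inE nz (subsetP sAX).
  by rewrite inE => /andP [_ /minimals_sub].
apply/is_antichainP=> y z.
case/setUP=> [/setD1P [ny Ay]|yN] /setUP [/setD1P [nz Az]|zN].
- exact: antichain_ltF aA _ _.
- move: zN; rewrite inE => /andP [_ /minimalsP [_ ]]; apply.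
  by rewrite !inE ny (subsetP sAX).
- apply/negP=> yz; have my := newP _ _ yN.
  by have := antichain_ltF aA Am Az; rewrite (lt_trans my yz).
- move: yN zN; rewrite ![_ \in new m]inE => /andP [_ yN] /andP [_ zN].
  exact: antichain_ltF (minimals_antichain (X :\ m)) _ _.
Qed.

(** An explicit list following the recursion of [ext_count_rec], which links that number to actual
    orderings. *)
Fixpoint exts_rec n X : seq (seq T) :=
  if n is n'.+1 then
    flatten [seq [seq x :: s | s <- exts_rec n' (X :\ x)]
            | x <- enum (minimals X)]
  else [:: [::]].

Lemma size_exts_rec n X : size (exts_rec n X) = ext_count_rec n X.
Proof.
elim: n X => //= n IH X; rewrite size_flatten /shape -map_comp sumnE big_map.
by rewrite big_enum /=; apply: eq_bigr => x _; rewrite size_map IH.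
Qed.

Lemma exts_recP n X s : #|X| = n ->
  reflect [/\ uniq s, s =i X & pairwise (fun x y : T => ~~ (y < x)%O) s]
          (s \in exts_rec n X).
Proof.
elim: n X s => [|n IH] X s eX /=.
  move/eqP: eX; rewrite cards_eq0 => /eqP ->; rewrite inE.
  apply: (iffP eqP) => [->|[_ es _]]; first by split=> // x; rewrite inE.
  by case: s es => // x s /(_ x); rewrite !inE eqxx.
have eD x : x \in X -> #|X :\ x| = n.
  by move=> Xx; move: eX; rewrite (cardsD1 x) Xx => -[].
apply: (iffP flatten_mapP) => [[x]|[]].
  rewrite mem_enum => /minimalsP [Xx minx] /mapP [t].
  case/(IH _ _ (eD x Xx))=> ut et pt ->.
  split=> /=.
  - by rewrite ut et !inE eqxx.
  - by move=> y; rewrite in_cons et !inE; case: eqP => // ->.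
  - rewrite pt andbT; apply/allP=> y; rewrite et !inE => /andP [_ /minx ->] //.
case: s => [|x s] /= us es ps.
  have X0 : X = set0 by apply/setP=> y; rewrite -es !inE.
  by rewrite X0 cards0 in eX.
have Xx : x \in X by rewrite -es mem_head.
case/andP: us => xs us; case/andP: ps => /allP xmin ps.
exists x.
  rewrite mem_enum; apply/minimalsP; split=> // y.
  rewrite -es in_cons => /predU1P [->|/xmin /negPf //]; exact: ltxx.
apply/mapP; exists s => //; apply/(IH _ _ (eD x Xx)); split=> // y.
by rewrite !inE -es in_cons; case: eqP => //= ->; apply/negbTE.
Qed.

Lemma exts_rec_uniq n X : uniq (exts_rec n X).
Proof.
elim: n X => //= n IH X.
have := enum_uniq (minimals X); elim: (enum _) => //= x l IHl /andP [xl ul].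
rewrite cat_uniq IHl // map_inj_uniq ?IH //=; last by move=> s t [].
rewrite andbT; apply/hasPn=> s /flatten_mapP [y yl /mapP [t _ ->]].
by apply/negP=> /mapP [t' _ [exy _]]; rewrite -exy yl in xl.
Qed.

(** An ordering [t] corresponds to the function [x] to [index x t]; this is a bijection onto the
    linear extensions. *)
Lemma num_linear_extensionsE : num_linear_extensions T = ext_count [set: T].
Proof.
rewrite /ext_count -size_exts_rec /num_linear_extensions.
set l := exts_rec _ _.
have lP t : t \in l -> [/\ uniq t, forall x, x \in t, size t = #|T| &
    forall x y, (x <= y)%O -> index x t <= index y t].
  case/(exts_recP _ (erefl _)) => ut et pt.
  have tT x : x \in t by rewrite et inE.
  split=> // [|x y le_xy].
    by rewrite -(card_uniqP ut); apply: eq_card => x; rewrite tT.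
  rewrite leqNgt; apply/negP=> lt_yx.
  have := pairwiseP x pt; move/(_ _ _ _ _ lt_yx).
  rewrite !nth_index // !inE !index_mem !tT => /(_ isT isT).
  rewrite lt_neqAle le_xy andbT negbK => /eqP exy.
  by rewrite exy ltnn in lt_yx.
(* [enum_rank x] is only a default, never reached for [t] in [l]. *)
pose F (t : seq T) : {ffun T -> 'I_#|T|} :=
  [ffun x => insubd (enum_rank x) (index x t)].
have FE t x : t \in l -> F t x = index x t :> nat.
  case/lP=> ut tT st _; rewrite ffunE val_insubd.
  by rewrite -[X in _ < X]st index_mem tT.
have F_inj : {in l &, injective F}.
  move=> t t' lt lt' eF.
  have [ut tT st _] := lP _ lt; have [ut' tT' st' _] := lP _ lt'.
  case et: t => [|x0 t1].
    by apply/esym/size0nil; rewrite st' -st et.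
  rewrite -et; apply: (@eq_from_nth _ x0) => [|i lt_i]; first by rewrite st st'.
  rewrite -[i in RHS](index_uniq x0 lt_i ut) -FE // eF FE //.
  by rewrite nth_index.
rewrite -(size_map F) -(card_uniqP _); last first.
  by rewrite map_inj_in_uniq // exts_rec_uniq.
apply: eq_card => f; rewrite inE; apply/idP/mapP; last first.
  case=> t lt ->; have [ut tT st leq_t] := lP _ lt; apply/and3P; split.
  - apply/injectiveP=> x y /(congr1 val) /=; rewrite !FE // => eI.
    by rewrite -(nth_index x (tT x)) eI nth_index.
  - apply/forallP=> i; apply/existsP.
    have lt_i : i < size t by rewrite st.
    have x0 : T by case: (t) lt_i => // x.
    exists (nth x0 t i); apply/eqP/val_inj; rewrite /= FE //.
    exact: index_uniq.
  - apply/forallP=> x; apply/forallP=> y; apply/implyP.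
    by rewrite !FE //; exact: leq_t.
case/and3P=> /injectiveP f_inj /forallP f_surj /forallP f_le.
pose g i := xchoose (existsP (f_surj i)).
have gK : cancel g f by move=> i; apply/eqP/(xchooseP (existsP (f_surj i))).
have fK : cancel f g by move=> x; apply: f_inj; rewrite gK.
have g_inj := can_inj gK.
(* The ordering behind [f] lists the preimages of 0, 1, and so on. *)
exists (map g (enum 'I_#|T|)).
  apply/exts_recP => //; split.
  - by rewrite map_inj_uniq ?enum_uniq.
  - by move=> x; rewrite inE -(fK x) map_f // mem_enum.
  - rewrite pairwise_map; apply: (@sub_pairwise _ (fun i j : 'I_#|T| => i < j)).
      move=> i j lt_ij; apply/negP=> /ltW le_ji.
      by have /forallP/(_ (g i))/implyP/(_ le_ji) := f_le (g j);
        rewrite !gK leqNgt lt_ij.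
    rewrite -(pairwise_map val ltn) val_enum_ord -sorted_pairwise.
      exact: iota_ltn_sorted.
    exact: ltn_trans.
apply/ffunP=> x; apply: val_inj; rewrite ffunE /= val_insubd.
have -> : index x (map g (enum 'I_#|T|)) = f x.
  by rewrite -{1}(fK x) index_map // index_enum_ord.
by rewrite ltn_ord.
Qed.

End LinearExtensions.

(** * The two inductions and the theorem *)

Section Bounds.

Variables (disp : Order.disp_t) (T : finPOrderType disp).
Implicit Types (X A C : {set T}).

Notation antichain_gain := (cover_gain (@is_antichain _ T)).
Notation chain_gain := (cover_gain (@is_chain _ T)).

Lemma prod_cover_gain0 (P : pred {set T}) :
  \prod_(k < #|T|) (cover_gain P set0 k)`! = 1.
Proof.
apply: big1 => k _; suff -> : cover_gain P set0 k = 0 by [].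
have := cover_in_le P set0 k.+1.
by rewrite /cover_gain cards0 leqn0 => /eqP ->.
Qed.

Lemma antichain_gain_ext_count X :
  \prod_(k < #|T|) (antichain_gain X k)`! <= ext_count X.
Proof.
have [n] := ubnP #|X|; elim: n X => // n IH X lt_n.
have [->|X0] := eqVneq X set0; first by rewrite prod_cover_gain0 ext_count0.
have [F aF eF] := cover_in_witness X 1 (@is_antichain0 _ T).
(* [A] is a maximum antichain of [X], so [#|A|] is the cap on the weights. *)
rewrite big_ord1 in eF; set A := X :&: F ord0 in eF.
have aA : is_antichain A.
  apply/is_antichainP=> x y /setIP [_ Fx] /setIP [_ Fy].
  exact: antichain_ltF (aF ord0) Fx Fy.
have A_gt0 : 0 < #|A|.
  rewrite -eF; have /set0Pn [x Xx] := X0.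
  apply: leq_trans (cover_in_ge X (F := fun=> [set x]) _) => [|_].
    rewrite big_ord1 card_gt0; apply/set0Pn; exists x.
    by rewrite in_setI Xx set11.
  exact: is_antichain1.
rewrite -(leq_pmul2l A_gt0).
apply: (@leq_trans (\sum_(x in A) #|A| * ext_count (X :\ x))).
  rewrite -sum_nat_const; apply: leq_sum => x /setIP [Xx _].
  apply: leq_trans (prod_cover_gainD1_le (@is_antichain0 _ T)
    (@is_antichain1 _ T) (@antichain_cover_concave _ T) Xx) _.
  rewrite eF leq_mul2l IH ?orbT //.
  by move: lt_n; rewrite (cardsD1 x) Xx.
rewrite -big_distrr leq_mul2l /= sum_ext_count_antichain ?orbT //.
exact: subsetIl.
Qed.

(** A point missed by an optimal family has drop 0. So the points of [A] with drop 1 lie in [k]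
    chains, each meeting [A] at most once. *)
Lemma sum_cover_drop_le X A k : is_antichain A ->
  \sum_(x in A) cover_drop (@is_chain _ T) X x k <= k.
Proof.
move=> aA; have [F cF eF] := cover_in_witness X k (@is_chain0 _ T).
have -> : \sum_(x in A) cover_drop (@is_chain _ T) X x k =
          #|A :&: [set x | cover_drop (@is_chain _ T) X x k]|.
  by rewrite card_setIE; apply: eq_bigr => x _; rewrite inE.
apply: (@card_transversal_le _ T k F).
  move=> i; apply: leq_trans (chain_antichain_card (cF i) aA).
  by rewrite setIC; apply/subset_leq_card/setIS/subsetIl.
apply/subsetP=> x; rewrite !inE => /andP [_]; apply: contraLR => nFx.
rewrite /cover_drop -leqNgt eF.
apply: leq_trans (cover_in_ge (X :\ x) cF); apply/subset_leq_card/subsetP=> y.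
rewrite !inE => /andP [-> Fy]; rewrite Fy !andbT.
by apply: contraNneq nFx => <-.
Qed.

Lemma ext_count_chain_gain X :
  ext_count X * \prod_(k < #|T|) (chain_gain X k)`! <= #|X|`!.
Proof.
have [n] := ubnP #|X|; elim: n X => // n IH X lt_n.
have [->|X0] := eqVneq X set0.
  by rewrite prod_cover_gain0 ext_count0 cards0.
have [m eX] : exists m, #|X| = m.+1.
  by move: X0; rewrite -card_gt0; case: #|X| => // m; exists m.
rewrite ext_countE // big_distrl /=.
pose w x := \sum_(k < #|T|) cover_drop (@is_chain _ T) X x k.+1 *
     (chain_gain X k - chain_gain X k.+1).
have gain_anti := cover_gain_anti (@is_chain0 _ T) (@chain_cover_concave _ T) X.
apply: (@leq_trans (\sum_(x in minimals X) m`! * w x)).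
  apply: leq_sum => x /minimals_sub Xx.
  have eXx : #|X :\ x| = m by move: eX; rewrite (cardsD1 x) Xx => -[].
  have := prod_cover_gainD1 (@is_chain0 _ T) (@is_chain1 _ T)
    (@chain_cover_concave _ T) Xx.
  move/(leq_mul (leqnn (ext_count (X :\ x))))/leq_trans; apply.
  rewrite mulnCA mulnC leq_mul2r -eXx IH ?orbT //.
  by rewrite eXx; move: lt_n; rewrite eX.
rewrite -big_distrr eX factS [leqRHS]mulnC leq_mul2l; apply/orP; right.
(* Summed over minimal points first, the drops at index [k.+1] contribute at most [k.+1]; summation
   by parts turns the bound into the sum of all gains, which is [#|X|]. *)
rewrite exchange_big /= -eX.
rewrite -(cover_in_full X (@is_chain0 _ T) (@is_chain1 _ T) (leqnn _)).
rewrite -sum_cover_gain; last exact: is_chain0.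
rewrite -(sum_by_parts gain_anti).
apply: leq_trans (leq_addr _ _); apply: leq_sum => k _.
rewrite -big_distrl leq_mul2r /= sum_cover_drop_le ?orbT //.
exact: minimals_antichain.
Qed.

Lemma prod_parametersE (P : pred {set T}) (a : nat -> nat) :
  gkf_parameters P a -> \prod_(1 <= i < #|T|.+1) (a i)`! =
  \prod_(k < #|T|) (cover_gain P [set: T] k)`!.
Proof.
move=> Pa; rewrite big_add1 big_mkord; apply: eq_bigr => k _.
by rewrite (gkf_parametersE _ Pa) /cover_gain !cover_in_setT.
Qed.

End Bounds.

Theorem theorem1 (disp : Order.disp_t) (T : finPOrderType disp)
    (a c : nat -> nat)
    (ha : antichain_parameters T a) (hc : chain_parameters T c) :
  ((#|T|`!)%:R / (\prod_(1 <= i < #|T|.+1) (c i)`!)%N%:R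
     >= (num_linear_extensions T)%:R :> rat)%R
  /\ num_linear_extensions T >= \prod_(1 <= i < #|T|.+1) (a i)`!.
Proof.
rewrite (prod_parametersE ha) (prod_parametersE hc) num_linear_extensionsE.
split; last exact: antichain_gain_ext_count.
rewrite ler_pdivlMr; last by rewrite ltr0n prodn_gt0 // => k; exact: fact_gt0.
rewrite -natrM ler_nat.
by have := ext_count_chain_gain [set: T]; rewrite cardsT.
Qed.
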